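(* Let $n,m,k$ be positive integers with $k\le m$, let $I=\{1,\dots,m\}$, $J=\{1,\dots,k\}$, and let ${\mathbf a}^1,\dots,{\mathbf a}^m\in\mathbb R^n$. Consider the problems (MIP) and (NS) defined in the context. If $(\bar{\mathbf x},\bar\alpha)$ is a solution of (MIP), then $\bar{\mathbf x}$ is a solution of (NS). Conversely, if $\bar{\mathbf x}$ is a solution of (NS), then the natural clustering $\{A^1,\dots,A^k\}$ associated with $\bar{\mathbf x}$ yields an incident matrix $\bar\alpha=(\bar\alpha_{ij})\in\mathbb R^{m\times k}$, given by $\bar\alpha_{ij}=1$ if ${\mathbf a}^i\in A^j$ and $\bar\alpha_{ij}=0$ otherwise, such that $(\bar{\mathbf x},\bar\alpha)$ is a solution of (MIP).
   Context: ''Solution'' means global solution (global minimizer). $\mathbb R^n$ carries the Euclidean norm $\|\cdot\|$; elements of $\mathbb R^{n\times k}$ are written $\mathbf x=({\mathbf x}^1,\dots,{\mathbf x}^k)$ with ${\mathbf x}^j\in\mathbb R^n$. The data set is $A=\{{\mathbf a}^1,\dots,{\mathbf a}^m\}$. (MIP): minimize $$\psi(\mathbf x,\alpha)=\frac1m\sum_{i=1}^m\Big(\sum_{j=1}^k\alpha_{ij}\|{\mathbf a}^i-{\mathbf x}^j\|^2\Big)$$ over all $\mathbf x\in\mathbb R^{n\times k}$ and all $\alpha=(\alpha_{ij})\in\mathbb R^{m\times k}$ with $\alpha_{ij}\in\{0,1\}$ for all $i\in I$, $j\in J$ and $\sum_{j=1}^k\alpha_{ij}=1$ for all $i\in I$.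 (NS): minimize $f(\mathbf x)=\frac1m\sum_{i=1}^m\big(\min_{j\in J}\|{\mathbf a}^i-{\mathbf x}^j\|^2\big)$ over all $\mathbf x\in\mathbb R^{n\times k}$. The natural clustering associated with $\bar{\mathbf x}=(\bar{\mathbf x}^1,\dots,\bar{\mathbf x}^k)\in\mathbb R^{n\times k}$ is the family $\{A^1,\dots,A^k\}$ of subsets of $A$ defined inductively by $A^0=\emptyset$ and $$A^j=\Big\{{\mathbf a}^i\in A\setminus\Big(\bigcup_{p=0}^{j-1}A^p\Big)\ \Big|\ \|{\mathbf a}^i-\bar{\mathbf x}^j\|=\min_{q\in J}\|{\mathbf a}^i-\bar{\mathbf x}^q\|\Big\},\qquad j\in J.$$ *)

(* Defs.v *)
From mathcomp Require Import all_boot all_order all_algebra.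
From mathcomp Require Import boolp classical_sets reals.

Set Implicit Arguments.
Unset Strict Implicit.
Unset Printing Implicit Defensive.

Import Order.TTheory GRing.Theory Num.Theory.

Local Open Scope classical_set_scope.
Local Open Scope ring_scope.

(* The norm that the analysis library puts on matrices is the max norm. *)
Definition enorm (R : realType) (n : nat) (v : 'cV[R]_n) : R :=
  Num.sqrt (\sum_(i < n) v i 0 ^+ 2).

(* The value for k = 0 is 0; see [min_ordP] for 0 < k. *)
Definition min_ord (R : realType) (k : nat) (F : 'I_k -> R) : R :=
  let s := [seq F q | q <- enum 'I_k] in
  \big[Num.min/head 0 s]_(v <- s) v.

Lemma min_ordP (R : realType) (k : nat) (F : 'I_k -> R) : (0 < k)%N ->
  (exists q, min_ord F = F q) /\ (forall q, min_ord F <= F q).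
Proof.
case: k F => // k F _; rewrite /min_ord; split; last first.
  move=> q; rewrite big_map; apply: bigmin_inf_seq (lexx _) => //.
  by rewrite mem_enum.
have hd : exists q, head 0 [seq F q | q <- enum 'I_k.+1] = F q.
  by exists ord0; rewrite enum_ordSl.
rewrite big_map; elim/big_ind: _ => //; last by move=> q _; exists q.
by move=> _ _ [p ->] [q ->]; case: (leP (F p) (F q)) => _; [exists p | exists q].
Qed.

Definition is_solution (R : realType) (T : Type) (S : set T) (g : T -> R)
    (z : T) : Prop :=
  S z /\ forall z', S z' -> g z <= g z'.

Section Clustering.
Variables (R : realType) (n m k : nat) (a : 'I_m -> 'cV[R]_n).
Implicit Types (x : 'M[R]_(n, k)) (alpha : 'M[R]_(m, k)).

Definition mip_objective (z : 'M[R]_(n, k) * 'M[R]_(m, k)) : R :=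
  m%:R^-1 * \sum_(i < m) \sum_(j < k)
    z.2 i j * enorm (a i - col j z.1) ^+ 2.

Definition mip_feasible : set ('M[R]_(n, k) * 'M[R]_(m, k)) :=
  [set z : 'M[R]_(n, k) * 'M[R]_(m, k) |
           (forall i j, z.2 i j = 0 \/ z.2 i j = 1) /\
           (forall i, \sum_(j < k) z.2 i j = 1)].

Definition mip_solution x alpha : Prop :=
  is_solution mip_feasible mip_objective (x, alpha).

Definition ns_objective x : R :=
  m%:R^-1 * \sum_(i < m) min_ord (fun j : 'I_k => enorm (a i - col j x) ^+ 2).

Definition ns_solution x : Prop := is_solution setT ns_objective x.

Definition nearest_outside x (B : set 'cV[R]_n) (j : 'I_k) : set 'cV[R]_n :=
  [set y | (range a `\` B) y /\
           enorm (y - col j x) = min_ord (fun q : 'I_k => enorm (y - col q x))].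

(* The union of the clusters of index < j; the inner union has the single
   index j.-1, and is there because the columns of x are indexed by 'I_k. *)
Fixpoint clustered x (j : nat) : set 'cV[R]_n :=
  if j is p.+1 then
    clustered x p `|`
    \bigcup_(q in [set q : 'I_k | q = p :> nat]) nearest_outside x (clustered x p) q
  else set0.

(* Indices start at 0, so the cluster of index 0 is the first one and the
   initial empty set of the induction is [clustered x 0]. *)
Definition natural_cluster x (j : 'I_k) : set 'cV[R]_n :=
  nearest_outside x (clustered x j) j.

Lemma natural_clusterE x (j : 'I_k) :
  natural_cluster x j =
  [set y | (range a `\`
              \bigcup_(p in [set p : 'I_k | (p < j)%N]) natural_cluster x p) y /\
           enorm (y - col j x) = min_ord (fun q : 'I_k => enorm (y - col q x))].
Proof.
suff clE (l : nat) : clustered x l =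
    \bigcup_(p in [set p : 'I_k | (p < l)%N]) natural_cluster x p.
  by rewrite {1}/natural_cluster clE.
elim: l => [|l IHl]; first by apply/esym/bigcup0 => p.
rewrite /= {1}IHl; apply/seteqP; split=> y.
  case=> [[p /= lt_pl yp]|[q /= ql yq]]; first by exists p => //=; exact: ltnW.
  by exists q; rewrite /= /natural_cluster ql.
case=> p /=; rewrite ltnS leq_eqVlt => /orP[/eqP pl|lt_pl] yp.
  by right; exists p => //; rewrite -pl.
by left; exists p.
Qed.

Definition incidence_mx (C : 'I_k -> set 'cV[R]_n) : 'M[R]_(m, k) :=
  \matrix_(i < m, j < k) (if a i \in C j then 1 else 0).

End Clustering.

(* Main.v *)
Require Import Defs.
From mathcomp Require Import all_boot all_order all_algebra.
From mathcomp Require Import boolp classical_sets reals.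

(** The nonsmooth problem is the mixed-integer one with the assignment variable
    minimized out.  For fixed centers, every row of a feasible assignment is a
    convex combination, so each data point costs at least its squared distance
    to a nearest center: the nonsmooth objective is a lower bound for the
    mixed-integer one ([ns_objective_le]).  The bound is attained by the
    incidence matrix of the natural clustering ([incidence_mx_feasible],
    [mip_objective_incidence]), since that clustering puts each point in
    exactly one cluster, that of the first of its nearest centers
    ([natural_cluster_first]).

    Both implications follow by chaining these two facts.  If (x, alpha) solves
    the mixed-integer problem, it beats (x', incidence matrix of x'), whose
    value is the nonsmooth objective at x'.  If x solves the nonsmooth problem,
    the value at (x, incidence matrix of x) is the nonsmooth minimum, which is
    below every feasible mixed-integer value. *)

Set Implicit Arguments.
Unset Strict Implicit.
Unset Printing Implicit Defensive.

Import Order.TTheory GRing.Theory Num.Theory.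

Local Open Scope classical_set_scope.
Local Open Scope ring_scope.

Lemma min_ord_eq (R : realType) (k : nat) (F : 'I_k -> R) (q0 : 'I_k) :
  (forall q, F q0 <= F q) -> min_ord F = F q0.
Proof.
move=> F_min; have k_gt0 : (0 < k)%N by case: k q0 F F_min => [[]|].
have [[q Fq] F_ge] := min_ordP F k_gt0.
by apply/eqP; rewrite eq_le F_ge Fq F_min.
Qed.

Lemma min_ord_sqr (R : realType) (k : nat) (F : 'I_k -> R) (q0 : 'I_k) :
  (forall q, 0 <= F q) -> F q0 = min_ord F ->
  min_ord (fun q => F q ^+ 2) = F q0 ^+ 2.
Proof.
move=> F_ge0 Fq0; have k_gt0 : (0 < k)%N by case: k q0 F F_ge0 Fq0 => [[]|].
apply: min_ord_eq => q; rewrite ler_sqr ?nnegrE // Fq0.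
exact: (min_ordP F k_gt0).2.
Qed.

Lemma first_min_ord (R : realType) (k : nat) (F : 'I_k -> R) : (0 < k)%N ->
  exists2 j0, F j0 = min_ord F &
    forall j : 'I_k, (j < j0)%N -> F j <> min_ord F.
Proof.
move=> k_gt0; have [[q Fq] _] := min_ordP F k_gt0.
case: (@arg_minnP _ q (fun j => F j == min_ord F) (@nat_of_ord k)).
  by rewrite Fq.
move=> j0 /eqP Fj0 j0_min; exists j0 => // j lt_jj0 /eqP /j0_min.
by rewrite leqNgt lt_jj0.
Qed.

(** Earlier clusters cannot contain the point, as their centers are not nearest
    to it; later ones cannot either, as the point has already been taken. *)
Lemma natural_cluster_first (R : realType) (n m k : nat)
    (a : 'I_m -> 'cV[R]_n) (x : 'M[R]_(n, k)) (i : 'I_m) : (0 < k)%N ->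
  exists2 j0 : 'I_k,
    enorm (a i - col j0 x) = min_ord (fun q => enorm (a i - col q x)) &
    forall j, (a i \in natural_cluster a x j) = (j == j0).
Proof.
move=> k_gt0.
have [j0 j0_near j0_first] :=
  first_min_ord (fun q : 'I_k => enorm (a i - col q x)) k_gt0.
have in_j0 : natural_cluster a x j0 (a i).
  rewrite natural_clusterE; split=> //; split; first by exists i.
  by case=> p /j0_first p_far; rewrite natural_clusterE => -[_ /p_far].
exists j0 => // j; apply/idP/eqP => [/set_mem|->]; last exact: mem_set.
rewrite natural_clusterE => -[[_ j_new] j_near].
case: (ltngtP j j0) => [/j0_first/(_ j_near)//|lt_j0j|/val_inj//].
by case: j_new; exists j0.
Qed.

Lemma incidence_mx_feasible (R : realType) (n m k : nat)
    (a : 'I_m -> 'cV[R]_n) (x : 'M[R]_(n, k)) : (0 < k)%N ->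
  mip_feasible (x, incidence_mx a (natural_cluster a x)).
Proof.
move=> k_gt0; split=> [i j|i] /=.
  by rewrite mxE; case: ifP => _; [right|left].
have [j0 _ in_clE] := natural_cluster_first a x i k_gt0.
under eq_bigr do rewrite mxE in_clE.
by rewrite -big_mkcond big_pred1_eq.
Qed.

Lemma mip_objective_incidence (R : realType) (n m k : nat)
    (a : 'I_m -> 'cV[R]_n) (x : 'M[R]_(n, k)) : (0 < k)%N ->
  mip_objective a (x, incidence_mx a (natural_cluster a x)) =
  ns_objective a x.
Proof.
move=> k_gt0; rewrite /mip_objective /ns_objective; congr (_ * _).
apply: eq_bigr => i _ /=.
have [j0 j0_near in_clE] := natural_cluster_first a x i k_gt0.
rewrite (min_ord_sqr _ j0_near) => [|q]; last exact: sqrtr_ge0.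
rewrite (bigD1 j0) //= mxE in_clE eqxx mul1r big1 ?addr0 // => j /negbTE j_j0.
by rewrite mxE in_clE j_j0 mul0r.
Qed.

(** Each row of a feasible assignment has nonnegative entries of sum 1, and a
    minimum is below every mean with such weights. *)
Lemma ns_objective_le (R : realType) (n m k : nat) (a : 'I_m -> 'cV[R]_n)
    (x : 'M[R]_(n, k)) (alpha : 'M[R]_(m, k)) : (0 < k)%N ->
  mip_feasible (x, alpha) -> ns_objective a x <= mip_objective a (x, alpha).
Proof.
move=> k_gt0 [/= alpha01 alpha_row].
apply: ler_wpM2l; first by rewrite invr_ge0 ler0n.
apply: ler_sum => i _ /=; set d := fun j => enorm _ ^+ 2.
rewrite -[min_ord d]mul1r -(alpha_row i) mulr_suml.
apply: ler_sum => j _; apply: ler_wpM2l; last exact: (min_ordP d k_gt0).2.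
by case: (alpha01 i j) => ->.
Qed.

Unset Implicit Arguments.

Theorem proposition1 (R : realType) (n m k : nat)
    (hn : (0 < n)%N) (hm : (0 < m)%N) (hk : (0 < k)%N) (hkm : (k <= m)%N)
    (a : 'I_m -> 'cV[R]_n) :
  (forall (x : 'M[R]_(n, k)) (alpha : 'M[R]_(m, k)),
     mip_solution a x alpha -> ns_solution a x) /\
  (forall x : 'M[R]_(n, k),
     ns_solution a x ->
     mip_solution a x (incidence_mx a (natural_cluster a x))).
Proof.
split=> [x alpha [feas opt]|x [_ opt]].
  split=> // x' _; apply: (le_trans (ns_objective_le a hk feas)).
  rewrite -(mip_objective_incidence a x' hk).
  exact/opt/incidence_mx_feasible.
split=> [|[x' alpha'] feas']; first exact: incidence_mx_feasible.
rewrite (mip_objective_incidence a x hk).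
exact: le_trans (opt x' I) (ns_objective_le a hk feas').
Qed.
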